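(* Let $(M,g_{ab})$ be a $3$-dimensional spacetime with signature $(-,+,+)$, and let $X_{abcd}$ be a real tensor field on $M$ satisfying $X_{abcd}=-X_{bacd}=-X_{abdc}$ (no other symmetry is assumed). Fix a point $x\in M$. For a covector $q\in T_x^*M$ put $Y^{ab}(q)=X^{ambn}q_mq_n$ and consider the homogeneous fourth order polynomial in $q$ $$P(q)=\frac12\left(Y^{k_1k_2}Y_{k_2k_1}-Y^{k_1}{}_{k_1}Y^{k_2}{}_{k_2}\right)=\frac12\left(X^{k_1i_2k_2i_1}X_{k_2j_2k_1j_1}-X^{i_1i_2}X_{j_1j_2}\right)q_{i_1}q_{i_2}q^{j_1}q^{j_2}.$$ Then $P$ factorizes as a product of two homogeneous quadratic polynomials in $q$ (with real coefficients).
   Context: Indices take values $0,1,2$ and are raised and lowered with $g_{ab}$; the summation convention is used. The contraction of $X$ is $X^{a}{}_{c}=X^{ab}{}_{cb}$. ''Homogeneous quadratic polynomial'' means a quadratic form in the components of $q$ (the zero form is allowed). *)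

(* Defs.v *)
From HB Require Import structures.
From mathcomp Require Import all_boot all_order all_algebra.
From mathcomp Require Import all_classical all_reals all_analysis.

Set Implicit Arguments.
Unset Strict Implicit.
Unset Printing Implicit Defensive.

Import Order.TTheory GRing.Theory Num.Theory.
Import numFieldNormedType.Exports.

Local Open Scope classical_set_scope.
Local Open Scope ring_scope.

(* Meant for open [U]: [f] is of class C^k on [U] when its iterated partial
   derivatives up to order [k] exist and those of order [k] are continuous. *)
Fixpoint Ck_on (R : realType) (n k : nat) (U : set 'rV[R]_n)
    (f : 'rV[R]_n -> R) : Prop :=
  match k with
  | 0 => forall u, U u -> {for u, continuous f}
  | k'.+1 =>
      (forall u (i : 'I_n), U u -> derivable f u (delta_mx 0 i)) /\
      (forall i : 'I_n, Ck_on k' U (fun u => 'D_(delta_mx 0 i) f u))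
  end.

Definition smooth_on (R : realType) (n : nat) (U : set 'rV[R]_n)
    (f : 'rV[R]_n -> R) : Prop :=
  forall k, Ck_on k U f.

(* [coord] and [inv] are total functions; only their values on [dom] and on
   [coord @` dom] are meaningful. *)
Record chart (R : realType) (n : nat) (M : topologicalType) := Chart {
  dom : set M;
  coord : M -> 'rV[R]_n;
  inv : 'rV[R]_n -> M;
  dom_open : open dom;
  img_open : open (coord @` dom);
  coord_continuous : {within dom, continuous coord};
  inv_continuous : {within coord @` dom, continuous inv};
  coordK : forall x, dom x -> inv (coord x) = x
}.

Definition transition (R : realType) (n : nat) (M : topologicalType)
    (c c' : chart R n M) : 'rV[R]_n -> 'rV[R]_n :=
  fun u => coord c' (inv c u).

Record smooth_manifold (R : realType) (n : nat) := SmoothManifold {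
  carrier :> topologicalType;
  atlas : set (chart R n carrier);
  manifold_hausdorff : hausdorff_space carrier;
  manifold_second_countable : @second_countable carrier;
  atlas_cover : forall x : carrier, exists2 c, atlas c & dom c x;
  atlas_smooth : forall c c', atlas c -> atlas c' -> forall i : 'I_n,
    smooth_on (coord c @` (dom c `&` dom c')) (fun u => transition c c' u 0 i)
}.

(* Since [jacobian] acts on row vectors, its entry in row [a] and column [a']
   is the partial derivative of the [a']-th coordinate of [c'] with respect to
   the [a]-th coordinate of [c]. *)
Definition chart_jacobian (R : realType) (n : nat) (M : smooth_manifold R n)
    (c c' : chart R n M) (x : M) : 'M[R]_n :=
  jacobian (transition c c') (coord c x).

(* A covariant tensor field is the family of its components in the charts of
   the atlas, subject to the transformation law on overlaps; components outside
   the domain of the chart are irrelevant. *)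
Definition is_tensor_field2 (R : realType) (n : nat) (M : smooth_manifold R n)
    (g : chart R n M -> M -> 'M[R]_n) : Prop :=
  forall c c', atlas c -> atlas c' -> forall x, dom c x -> dom c' x ->
  forall a b : 'I_n,
    g c x a b = \sum_a' \sum_b'
      chart_jacobian c c' x a a' * chart_jacobian c c' x b b' * g c' x a' b'.

Definition tensor4 (R : realType) (n : nat) : Type :=
  'I_n -> 'I_n -> 'I_n -> 'I_n -> R.

Definition is_tensor_field4 (R : realType) (n : nat) (M : smooth_manifold R n)
    (X : chart R n M -> M -> tensor4 R n) : Prop :=
  forall c c', atlas c -> atlas c' -> forall x, dom c x -> dom c' x ->
  forall a b d e : 'I_n,
    X c x a b d e = \sum_a' \sum_b' \sum_d' \sum_e'
      chart_jacobian c c' x a a' * chart_jacobian c c' x b b' *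
      chart_jacobian c c' x d d' * chart_jacobian c c' x e e' *
      X c' x a' b' d' e'.

(* Signature (-,+,+): some basis (the rows of [E]) is orthonormal, with one
   timelike and two spacelike vectors. *)
Definition lorentz_signature (R : realType) (g : 'M[R]_3) : Prop :=
  g^T = g /\
  exists2 E : 'M[R]_3, E \in unitmx &
    E *m g *m E^T = diag_mx (\row_(i < 3) if i == 0 then -1 else 1).

Definition lorentz_metric (R : realType) (M : smooth_manifold R 3)
    (g : chart R 3 M -> M -> 'M[R]_3) : Prop :=
  [/\ is_tensor_field2 g,
      forall c, atlas c -> forall a b : 'I_3,
        smooth_on (coord c @` dom c) (fun u => g c (inv c u) a b) &
      forall c, atlas c -> forall x, dom c x -> lorentz_signature (g c x)].

(* From here on [g] is the matrix of components g_{ab} at one point, so that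
   [invmx g] has components g^{ab}. *)

Definition raise1 (R : realType) (g : 'M[R]_3) (q : 'rV[R]_3) : 'rV[R]_3 :=
  \row_a \sum_b invmx g a b * q 0 b.

Definition raise2 (R : realType) (g T : 'M[R]_3) : 'M[R]_3 :=
  \matrix_(a, b) \sum_a' \sum_b' invmx g a a' * invmx g b b' * T a' b'.

Definition lower2 (R : realType) (g T : 'M[R]_3) : 'M[R]_3 :=
  \matrix_(a, b) \sum_a' \sum_b' g a a' * g b b' * T a' b'.

Definition raise4 (R : realType) (g : 'M[R]_3) (X : tensor4 R 3) : tensor4 R 3 :=
  fun a b c d => \sum_a' \sum_b' \sum_c' \sum_d'
    invmx g a a' * invmx g b b' * invmx g c c' * invmx g d d' * X a' b' c' d'.

(* X_{ac} = g^{bd} X_{abcd}, that is X^{ab}_{cb} with the index a lowered. *)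
Definition contraction (R : realType) (g : 'M[R]_3) (X : tensor4 R 3) : 'M[R]_3 :=
  \matrix_(a, c) \sum_b \sum_d invmx g b d * X a b c d.

(* Y^{ab} = X^{ambn} q_m q_n *)
Definition Yup (R : realType) (g : 'M[R]_3) (X : tensor4 R 3) (q : 'rV[R]_3) :
    'M[R]_3 :=
  \matrix_(a, b) \sum_m \sum_n raise4 g X a m b n * q 0 m * q 0 n.

(* Y^k_k *)
Definition Ytrace (R : realType) (g : 'M[R]_3) (X : tensor4 R 3) (q : 'rV[R]_3) :
    R :=
  \sum_k \sum_l g k l * Yup g X q k l.

Definition quartic_P (R : realType) (g : 'M[R]_3) (X : tensor4 R 3)
    (q : 'rV[R]_3) : R :=
  2^-1 * ((\sum_k1 \sum_k2 Yup g X q k1 k2 * lower2 g (Yup g X q) k2 k1)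
          - Ytrace g X q * Ytrace g X q).

Definition quartic_P_expanded (R : realType) (g : 'M[R]_3) (X : tensor4 R 3)
    (q : 'rV[R]_3) : R :=
  2^-1 * \sum_i1 \sum_i2 \sum_j1 \sum_j2
    ((\sum_k1 \sum_k2 raise4 g X k1 i2 k2 i1 * X k2 j2 k1 j1)
     - raise2 g (contraction g X) i1 i2 * contraction g X j1 j2)
    * q 0 i1 * q 0 i2 * raise1 g q 0 j1 * raise1 g q 0 j2.

Definition is_quadratic_form (R : realType) (Q : 'rV[R]_3 -> R) : Prop :=
  exists A : 'M[R]_3, forall q, Q q = \sum_a \sum_b A a b * q 0 a * q 0 b.

(* Main.v *)
(* In dimension 3 a tensor antisymmetric in each of two index pairs is
   [X^{abcd} = eps^{abe} eps^{cdf} Z_{ef}].  Hence [Y = K Z K^T], where [K] is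
   the antisymmetric matrix of the cross product with [q], and
   [adj K = q q^T].  Since [P] is minus the second elementary symmetric
   function of [Y g],
     [P = - tr (adj (Y g)) = - (q^T (adj g) q) (q^T (adj Z) q)]. *)
Require Import Defs.
From HB Require Import structures.
From mathcomp Require Import all_boot all_order all_algebra.
From mathcomp Require Import all_classical all_reals all_analysis.
From mathcomp Require Import ring.

Set Implicit Arguments.
Unset Strict Implicit.
Unset Printing Implicit Defensive.

Import GRing.Theory Num.Theory.

Local Open Scope ring_scope.

(** * Cyclic indices, the double dual and the factorization *)

Lemma sum_ord3 (V : nmodType) (F : 'I_3 -> V) :
  \sum_i F i = F 0 + F 1 + F (1 + 1).
Proof.
rewrite !big_ord_recl big_ord0 addr0 addrA.
by congr (F _ + F _ + F _); apply/val_inj.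
Qed.

Lemma addr1_ord3 (i : 'I_3) : i + 1 + 1 + 1 = i.
Proof.
rewrite -!addrA (_ : 1 + (1 + 1) = 0) ?addr0 //; exact/val_inj.
Qed.

(** Starting the sum at a symbolic index [i] lets [ring] treat all matrix entries at once, without a
    case split on the indices. *)
Lemma sum_cyc3 (V : nmodType) (i : 'I_3) (F : 'I_3 -> V) :
  \sum_j F j = F i + F (i + 1) + F (i + 1 + 1).
Proof. by rewrite (reindex_inj (addrI i)) sum_ord3 addr0 addrA. Qed.

(* The indices are cyclic, so that no signs occur. *)
Definition cofactor3 (R : comPzRingType) (A : 'M[R]_3) : 'M[R]_3 :=
  \matrix_(a, b) (A (a + 1) (b + 1) * A (a + 1 + 1) (b + 1 + 1)
                  - A (a + 1) (b + 1 + 1) * A (a + 1 + 1) (b + 1)).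

(* [Z_{ef} = eps_{abe} eps_{cdf} T^{abcd} / 4] *)
Definition double_dual (R : realType) (T : tensor4 R 3) : 'M[R]_3 :=
  \matrix_(e, f) T (e + 1) (e + 1 + 1) (f + 1) (f + 1 + 1).

Definition pair_antisym (R : realType) (T : tensor4 R 3) : Prop :=
  forall a b d e, T a b d e = - T b a d e /\ T a b d e = - T a b e d.

Lemma pair_antisym_diagl (R : realType) (T : tensor4 R 3) a d e :
  pair_antisym T -> T a a d e = 0.
Proof.
move=> asT; have [h _] := asT a a d e.
by apply/eqP; rewrite -[_ == 0](mulrn_eq0 _ 2) mulr2n {1}h addNr.
Qed.

Lemma pair_antisym_diagr (R : realType) (T : tensor4 R 3) a b d :
  pair_antisym T -> T a b d d = 0.
Proof.
move=> asT; have [_ h] := asT a b d d.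
by apply/eqP; rewrite -[_ == 0](mulrn_eq0 _ 2) mulr2n {1}h addNr.
Qed.

Lemma raise4_antisym (R : realType) (g : 'M[R]_3) (X : tensor4 R 3) :
  pair_antisym X -> pair_antisym (raise4 g X).
Proof.
move=> asX a b d e; rewrite /raise4; split.
- rewrite exchange_big -sumrN; apply: eq_bigr => i _.
  rewrite -sumrN; apply: eq_bigr => j _.
  rewrite -sumrN; apply: eq_bigr => k _.
  rewrite -sumrN; apply: eq_bigr => l _.
  have [-> _] := asX j i k l; ring.
- rewrite -sumrN; apply: eq_bigr => i _.
  rewrite -sumrN; apply: eq_bigr => j _.
  rewrite exchange_big -sumrN; apply: eq_bigr => k _.
  rewrite -sumrN; apply: eq_bigr => l _.
  have [_ ->] := asX i j l k; ring.
Qed.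

(* [Y = K Z K^T] with [K] the matrix of the cross product with [q]. *)
Lemma Yup_double_dual (R : realType) (g : 'M[R]_3) (X : tensor4 R 3)
    (q : 'rV[R]_3) (a b : 'I_3) (Z := double_dual (raise4 g X)) :
  pair_antisym X ->
  Yup g X q a b =
    q 0 (a + 1) * q 0 (b + 1) * Z (a + 1 + 1) (b + 1 + 1)
    - q 0 (a + 1) * q 0 (b + 1 + 1) * Z (a + 1 + 1) (b + 1)
    - q 0 (a + 1 + 1) * q 0 (b + 1) * Z (a + 1) (b + 1 + 1)
    + q 0 (a + 1 + 1) * q 0 (b + 1 + 1) * Z (a + 1) (b + 1).
Proof.
move/(raise4_antisym g) => asT; rewrite /Z !mxE.
rewrite (sum_cyc3 a) !(sum_cyc3 b) !addr1_ord3.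
set T := raise4 g X in asT *.
have s1 x y z w : T x y z w = - T y x z w by have [] := asT x y z w.
have s2 x y z w : T x y z w = - T x y w z by have [] := asT x y z w.
(* Terms with a repeated index vanish. The pairs (a + 2, a) and (b + 2, b) coming from [Z] are then
   reversed, each at the cost of a sign, so that both sides use the same entries of [T]. *)
rewrite !(pair_antisym_diagl _ _ _ asT) !(pair_antisym_diagr _ _ _ asT).
rewrite !(s1 (a + 1 + 1) a) !(s2 _ _ (b + 1 + 1) b).
ring.
Qed.

(** Cofactor matrices are multiplicative and that of K is q q^T, so Y = K Z K^T has cofactor matrix
    q q^T C q q^T, with C the cofactor matrix of Z. *)
Lemma cofactor3_Yup (R : realType) (g : 'M[R]_3) (X : tensor4 R 3)
    (q : 'rV[R]_3) (a b : 'I_3) (Z := double_dual (raise4 g X)) :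
  pair_antisym X ->
  cofactor3 (Yup g X q) a b =
    (\sum_c \sum_d cofactor3 Z c d * q 0 c * q 0 d) * (q 0 a * q 0 b).
Proof.
move=> asX; rewrite mxE !(Yup_double_dual _ _ _ _ asX) -/Z.
rewrite (sum_cyc3 a) !(sum_cyc3 b).
do ![rewrite [cofactor3 _ _ _]mxE]; rewrite !addr1_ord3; ring.
Qed.

(** With W = Y g the left-hand side is (tr W^2 - (tr W)^2) / 2 = - tr (adj W), and adj W = adj g adj
    Y. Symmetry of g turns this trace into the entrywise pairing of cofactors. *)
Lemma half_tr_sqr (R : realType) (g Y : 'M[R]_3) :
  g^T = g ->
  2^-1 * ((\sum_k \sum_l Y k l * lower2 g Y l k)
          - (\sum_k \sum_l g k l * Y k l) * (\sum_k \sum_l g k l * Y k l)) =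
  - \sum_a \sum_b cofactor3 g a b * cofactor3 Y a b.
Proof.
move=> symg; have sg i j : g j i = g i j by rewrite -{1}symg mxE.
rewrite !sum_ord3 !mxE !sum_ord3.
rewrite (_ : 1 + 1 + 1 = 0 :> 'I_3); last exact/val_inj.
rewrite !add0r (sg 0 1) (sg 0 (1 + 1)) (sg 1 (1 + 1)).
by field.
Qed.

Lemma quartic_P_factor (R : realType) (g : 'M[R]_3) (X : tensor4 R 3)
    (q : 'rV[R]_3) (Z := double_dual (raise4 g X)) :
  g^T = g -> pair_antisym X ->
  quartic_P g X q =
    (\sum_a \sum_b (- cofactor3 g) a b * q 0 a * q 0 b) *
    (\sum_a \sum_b cofactor3 Z a b * q 0 a * q 0 b).
Proof.
move=> symg asX; rewrite /quartic_P /Ytrace half_tr_sqr // -sumrN mulr_suml.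
apply: eq_bigr => a _; rewrite -sumrN mulr_suml; apply: eq_bigr => b _.
rewrite cofactor3_Yup // [(- cofactor3 g) a b]mxE; ring.
Qed.

(** * Nondegeneracy of the metric; raising and lowering indices *)

Lemma lorentz_signature_unit (R : realType) (g : 'M[R]_3) :
  lorentz_signature g -> g \in unitmx.
Proof.
move=> [_ [E uE /(congr1 (fun A => \det A))]].
(* A vanishing det g would make the product of the diagonal entries -1, 1, 1 vanish. *)
rewrite !det_mulmx det_tr det_diag => detE.
rewrite unitmxE unitfE; apply/eqP => g0.
move: detE; rewrite g0 mulr0 mul0r => /esym/eqP; apply/negP.
apply/prodf_neq0 => i _; rewrite mxE.
by case: ifP => _; rewrite ?oppr_eq0 oner_eq0.
Qed.

(** The covariant Y_{ab}, as a function of the vector v^m = g^{mn} q_n; in this form no metric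
    appears. *)
Definition Ydown (R : realType) (X : tensor4 R 3) (v : 'rV[R]_3) : 'M[R]_3 :=
  \matrix_(a, b) \sum_m \sum_n X a m b n * v 0 m * v 0 n.

Lemma raise1E (R : realType) (g : 'M[R]_3) (q : 'rV[R]_3) :
  raise1 g q = q *m (invmx g)^T.
Proof.
by apply/rowP => a; rewrite !mxE; apply: eq_bigr => b _; rewrite mxE mulrC.
Qed.

Lemma mulmx2E (R : realType) (A T : 'M[R]_3) a b :
  (A *m T *m A^T) a b = \sum_a' \sum_b' A a a' * A b b' * T a' b'.
Proof.
rewrite mxE exchange_big; apply: eq_bigr => b' _.
rewrite !mxE mulr_suml; apply: eq_bigr => a' _; ring.
Qed.

Lemma raise2E (R : realType) (g T : 'M[R]_3) :
  raise2 g T = invmx g *m T *m (invmx g)^T.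
Proof. by apply/matrixP => a b; rewrite mulmx2E mxE. Qed.

Lemma lower2E (R : realType) (g T : 'M[R]_3) : lower2 g T = g *m T *m g^T.
Proof. by apply/matrixP => a b; rewrite mulmx2E mxE. Qed.

Lemma quad_formE (R : realType) (A : 'M[R]_3) (v : 'rV[R]_3) :
  (v *m A *m v^T) 0 0 = \sum_a \sum_b A a b * v 0 a * v 0 b.
Proof.
rewrite mxE exchange_big; apply: eq_bigr => b _.
rewrite !mxE mulr_suml; apply: eq_bigr => a _; ring.
Qed.

(** The slots contracted with q are raised on q instead of on X, by symmetry of the inverse metric;
    the two free indices are raised afterwards. *)
Lemma YupE (R : realType) (g : 'M[R]_3) (X : tensor4 R 3) (q : 'rV[R]_3) :
  g^T = g -> Yup g X q = raise2 g (Ydown X (raise1 g q)).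
Proof.
move=> symg; have symh i j : invmx g i j = invmx g j i.
  by rewrite -{1}symg -trmx_inv mxE.
apply/matrixP => a b; rewrite !mxE pair_big.
(* The pair [p] is (m, n). The primed indices are pulled out one at a time, in the order a', b', m',
   n' of the right-hand side. *)
under eq_bigr => p _ do rewrite -mulrA mulr_suml.
rewrite exchange_big; apply: eq_bigr => a' _.
under eq_bigr => p _ do rewrite exchange_big mulr_suml.
rewrite exchange_big; apply: eq_bigr => b' _.
under eq_bigr => p _ do rewrite mulr_suml.
rewrite exchange_big mxE mulr_sumr; apply: eq_bigr => m' _.
under eq_bigr => p _ do rewrite mulr_suml.
rewrite exchange_big mulr_sumr; apply: eq_bigr => n' _ /=.
rewrite !mxE -(mulrA (X _ _ _ _)) big_distrlr pair_big !mulr_sumr.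
by apply: eq_bigr => p _ /=; rewrite (symh p.1) (symh p.2); ring.
Qed.

Lemma lower2_Yup (R : realType) (g : 'M[R]_3) (X : tensor4 R 3) (q : 'rV[R]_3) :
  g^T = g -> g \in unitmx -> lower2 g (Yup g X q) = Ydown X (raise1 g q).
Proof.
move=> symg ug; rewrite YupE // lower2E raise2E !mulmxA mulmxV // mul1mx.
by rewrite -mulmxA -trmx_mul mulmxV // trmx1 mulmx1.
Qed.

(** Flipping both index pairs, X_{akbl} = X_{kalb}, moves the trace from the second and fourth slots
    to the first and third; the signs cancel. *)
Lemma contraction_form (R : realType) (g : 'M[R]_3) (X : tensor4 R 3)
    (v : 'rV[R]_3) :
  pair_antisym X ->
  \sum_a \sum_b Defs.contraction g X a b * v 0 a * v 0 b =
  \sum_k \sum_l invmx g k l * Ydown X v k l.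
Proof.
move=> asX.
under eq_bigr => a _ do under eq_bigr => b _ do
  rewrite mxE pair_big -mulrA mulr_suml.
under [RHS]eq_bigr => k _ do under eq_bigr => l _ do
  rewrite mxE pair_big mulr_sumr.
rewrite pair_big [RHS]pair_big exchange_big; apply: eq_bigr => -[k l] _.
apply: eq_bigr => -[a b] _ /=.
have [-> _] := asX a k b l; have [_ ->] := asX k a b l; ring.
Qed.

Lemma Ytrace_down (R : realType) (g : 'M[R]_3) (X : tensor4 R 3) (q : 'rV[R]_3) :
  g^T = g -> g \in unitmx -> pair_antisym X ->
  Ytrace g X q = \sum_a \sum_b Defs.contraction g X a b *
    raise1 g q 0 a * raise1 g q 0 b.
Proof.
move=> symg ug asX; rewrite contraction_form // /Ytrace YupE //.
have tr_form (A B : 'M[R]_3) : \sum_k \sum_l A k l * B k l = \tr (A^T *m B).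
  rewrite exchange_big; apply: eq_bigr => l _; rewrite mxE.
  by apply: eq_bigr => k _; rewrite mxE.
rewrite !tr_form raise2E symg !mulmxA mulmxV // mul1mx.
by rewrite mxtrace_mulC.
Qed.

(** The expanded quartic writes one trace factor with q_i and the other with q^j; this form serves
    the former, [Ytrace_down] the latter. *)
Lemma Ytrace_up (R : realType) (g : 'M[R]_3) (X : tensor4 R 3) (q : 'rV[R]_3) :
  g^T = g -> g \in unitmx -> pair_antisym X ->
  Ytrace g X q =
    \sum_a \sum_b raise2 g (Defs.contraction g X) a b * q 0 a * q 0 b.
Proof.
move=> symg ug asX; rewrite Ytrace_down // -!quad_formE raise1E raise2E.
by rewrite trmx_mul trmx_inv symg trmx_inv symg !mulmxA.
Qed.

(** * The expanded quartic and the conclusion *)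

Lemma sum_form_prod (R : comPzRingType) (n : nat)
    (A B : 'I_n -> 'I_n -> 'I_n -> 'I_n -> R) (C D : 'I_n -> 'I_n -> R)
    (u v : 'I_n -> R) :
  \sum_i1 \sum_i2 \sum_j1 \sum_j2
    ((\sum_k1 \sum_k2 A k1 i2 k2 i1 * B k2 j2 k1 j1) - C i1 i2 * D j1 j2)
    * u i1 * u i2 * v j1 * v j2 =
  \sum_k1 \sum_k2 (\sum_m \sum_n A k1 m k2 n * u m * u n) *
                  (\sum_m \sum_n B k2 m k1 n * v m * v n)
  - (\sum_a \sum_b C a b * u a * u b) * (\sum_a \sum_b D a b * v a * v b).
Proof.
(* Bundling p = (i1, i2), r = (j1, j2), k = (k1, k2) reduces the identity to distributivity over
   single sums. *)
transitivity (\sum_(p : 'I_n * 'I_n) \sum_(r : 'I_n * 'I_n)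
    ((\sum_(k : 'I_n * 'I_n) (A k.1 p.2 k.2 p.1 * u p.2 * u p.1) *
                              (B k.2 r.2 k.1 r.1 * v r.2 * v r.1))
     - (C p.1 p.2 * u p.1 * u p.2) * (D r.1 r.2 * v r.1 * v r.2))).
  rewrite pair_big; apply: eq_bigr => p _; rewrite pair_big.
  apply: eq_bigr => r _; rewrite pair_big /= !mulrBl !mulr_suml.
  by congr (_ - _); [apply: eq_bigr => k _|]; ring.
under eq_bigr => p _ do rewrite sumrB.
rewrite sumrB; congr (_ - _); last first.
  by rewrite [X in _ = X * _]pair_big [X in _ = _ * X]pair_big big_distrlr.
under eq_bigr => p _ do rewrite exchange_big.
rewrite exchange_big [RHS]pair_big; apply: eq_bigr => k _ /=.
(* In [A k1 i2 k2 i1] and [B k2 j2 k1 j1] the second index of each bundled pair comes first, so the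
   sums over m and n are swapped. *)
rewrite [X in _ = X * _]exchange_big [X in _ = _ * X]exchange_big.
by rewrite [X in _ = X * _]pair_big [X in _ = _ * X]pair_big big_distrlr.
Qed.

Lemma quartic_P_expandedE (R : realType) (g : 'M[R]_3) (X : tensor4 R 3)
    (q : 'rV[R]_3) :
  g^T = g -> g \in unitmx -> pair_antisym X ->
  quartic_P g X q = quartic_P_expanded g X q.
Proof.
move=> symg ug asX; rewrite /quartic_P /quartic_P_expanded sum_form_prod.
rewrite lower2_Yup // {1}Ytrace_up // Ytrace_down //.
congr (_ * (_ - _)); apply: eq_bigr => k1 _; apply: eq_bigr => k2 _.
by rewrite !mxE.
Qed.

Theorem theorem1 (R : realType) (M : smooth_manifold R 3)
    (g : chart R 3 M -> M -> 'M[R]_3) (g_lorentz : lorentz_metric g)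
    (X : chart R 3 M -> M -> tensor4 R 3) (X_tensor : is_tensor_field4 X)
    (X_antisym : forall c, atlas c -> forall x, dom c x ->
       forall a b d e : 'I_3,
         X c x a b d e = - X c x b a d e /\ X c x a b d e = - X c x a b e d)
    (x : M) (c : chart R 3 M) (c_atlas : atlas c) (c_x : dom c x) :
  (forall q : 'rV[R]_3,
     quartic_P (g c x) (X c x) q = quartic_P_expanded (g c x) (X c x) q) /\
  (exists Q1 Q2 : 'rV[R]_3 -> R,
     [/\ is_quadratic_form Q1, is_quadratic_form Q2 &
         forall q : 'rV[R]_3, quartic_P (g c x) (X c x) q = Q1 q * Q2 q]).
Proof.
have [_ _ /(_ c c_atlas x c_x) sig] := g_lorentz.
have [symg _] := sig; have ug := lorentz_signature_unit sig.
have asX : pair_antisym (X c x) := X_antisym c c_atlas x c_x.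
split=> [q|]; first exact: quartic_P_expandedE.
(* This form is - det g times g^{ab} q_a q_b, a positive multiple in Lorentz signature; X enters
   only through the second form. *)
exists (fun q => \sum_a \sum_b (- cofactor3 (g c x)) a b * q 0 a * q 0 b).
exists (fun q => \sum_a \sum_b
  cofactor3 (double_dual (raise4 (g c x) (X c x))) a b * q 0 a * q 0 b).
split=> [||q]; [by eexists|by eexists|exact: quartic_P_factor].
Qed.
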